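(* Let $\Bbbk$ be a field and $\mathcal{C}$ an additive pivotal $\Bbbk$-category in which every indecomposable object is absolutely indecomposable and every element of the radical of the endomorphism ring of an indecomposable object is nilpotent. Let $V$ be an absolutely simple object, fix a decomposition $V\otimes V^*=\bigoplus_{k\in I}W_k$ into indecomposables with inclusions $i_k$, projections $p_k$ and idempotents $e_k=i_kp_k$. Let $j\in I$ be the unique index with $e_j\,\mathrm{coev}_V=\mathrm{coev}_V$ and $j'\in I$ the unique index with $\widetilde{\mathrm{ev}}_V\,e_{j'}=\widetilde{\mathrm{ev}}_V$. Then the following are equivalent: (1) $V$ is right ambidextrous; (2) $j=j'$; (3) $W_j^*\cong W_j$.
   Context: A pivotal $\Bbbk$-category has left duality $(V^*,\mathrm{coev}_V:\mathbb{1}\to V\otimes V^*,\mathrm{ev}_V:V^*\otimes V\to\mathbb{1})$ and compatible right duality $(\widetilde{\mathrm{coev}}_V:\mathbb{1}\to V^*\otimes V,\widetilde{\mathrm{ev}}_V:V\otimes V^*\to\mathbb{1})$; hom-sets are $\Bbbk$-vector spaces with bilinear composition and tensor product, and $\operatorname{End}(\mathbb{1})=\Bbbk$. For $f:V\to W$ the dual is $f^*=(\mathrm{ev}_W\otimes\mathrm{Id}_{V^*})(\mathrm{Id}_{W^*}\otimes f\otimes\mathrm{Id}_{V^*})(\mathrm{Id}_{W^*}\otimes\mathrm{coev}_V)$. Let $\phi_V=(\widetilde{\mathrm{ev}}_V\otimes\mathrm{Id}_{V^{**}})(\mathrm{Id}_V\otimes\mathrm{coev}_{V^*}):V\to V^{**}$.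 An absolutely simple object $V$ (one with $\operatorname{End}(V)=\Bbbk\,\mathrm{Id}_V$) is right ambidextrous if $f\,\mathrm{coev}_V=(\phi_V^{-1}\otimes\mathrm{Id}_{V^*})\,f^*\,\widetilde{\mathrm{coev}}_{V^*}$ for all $f\in\operatorname{End}_{\mathcal{C}}(V\otimes V^* )$. An object is absolutely indecomposable if its endomorphism ring modulo its radical is $\Bbbk$. *)

(* Defs.v *)
From HB Require Import structures.
From mathcomp Require Import all_boot all_order all_algebra.
Set Implicit Arguments.
Unset Strict Implicit.
Unset Printing Implicit Defensive.
Import GRing.Theory.
Local Open Scope ring_scope.

Record PreCat (K : fieldType) := {
  Ob : Type;
  Mor : Ob -> Ob -> lmodType K;
  idm : forall A, Mor A A;
  mcomp : forall A B C, Mor B C -> Mor A B -> Mor A C;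
  tens : Ob -> Ob -> Ob;
  tunit : Ob;
  tensm : forall A B C D, Mor A B -> Mor C D -> Mor (tens A C) (tens B D);
  asc : forall A B C, Mor (tens (tens A B) C) (tens A (tens B C));
  ascinv : forall A B C, Mor (tens A (tens B C)) (tens (tens A B) C);
  lu : forall A, Mor (tens tunit A) A;
  luinv : forall A, Mor A (tens tunit A);
  ru : forall A, Mor (tens A tunit) A;
  ruinv : forall A, Mor A (tens A tunit);
  dual : Ob -> Ob;
  coev : forall V, Mor tunit (tens V (dual V));
  ev : forall V, Mor (tens (dual V) V) tunit;
  coevt : forall V, Mor tunit (tens (dual V) V);
  evt : forall V, Mor (tens V (dual V)) tunit
}.

Arguments idm {K C} A : rename.
Arguments mcomp {K C A B C0} _ _ : rename.
Arguments tens {K} C _ _ : rename.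
Arguments tunit {K} C : rename.
Arguments tensm {K C A B C0 D} _ _ : rename.
Arguments asc {K C} A B C0 : rename.
Arguments ascinv {K C} A B C0 : rename.
Arguments lu {K C} A : rename.
Arguments luinv {K C} A : rename.
Arguments ru {K C} A : rename.
Arguments ruinv {K C} A : rename.
Arguments dual {K C} _ : rename.
Arguments coev {K C} V : rename.
Arguments ev {K C} V : rename.
Arguments coevt {K C} V : rename.
Arguments evt {K C} V : rename.
Arguments Mor {K} C _ _ : rename.
Arguments Ob {K} C : rename.

Section Derived.
Context {K : fieldType} (C : PreCat K).

Local Notation "g \; f" := (mcomp f g) (at level 60, right associativity).
(* f \; g  means "first f, then g" *)
Local Notation "f (x) g" := (tensm f g) (at level 40, left associativity).
Local Notation tns := (tens C).
Local Notation one := (tunit C).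

Definition ldualm (V W : Ob C) (f : Mor C V W) : Mor C (dual W) (dual V) :=
  ruinv (dual W) \; (idm (dual W) (x) coev V) \; (idm (dual W) (x) (f (x) idm (dual V)))
  \; ascinv (dual W) W (dual V) \; (ev W (x) idm (dual V)) \; lu (dual V).

Definition rdualm (V W : Ob C) (f : Mor C V W) : Mor C (dual W) (dual V) :=
  luinv (dual W) \; (coevt V (x) idm (dual W)) \; ((idm (dual V) (x) f) (x) idm (dual W))
  \; asc (dual V) W (dual W) \; (idm (dual V) (x) evt W) \; ru (dual V).

Definition leta (V W : Ob C) : Mor C one (tns (tns V W) (tns (dual W) (dual V))) :=
  coev V \; ((ruinv V \; (idm V (x) coev W)) (x) idm (dual V))
  \; (ascinv V W (dual W) (x) idm (dual V)) \; asc (tns V W) (dual W) (dual V).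

Definition lgamma (V W : Ob C) :
  Mor C (dual (tns V W)) (tns (dual W) (dual V)) :=
  ruinv (dual (tns V W)) \; (idm (dual (tns V W)) (x) leta V W)
  \; ascinv (dual (tns V W)) (tns V W) (tns (dual W) (dual V))
  \; (ev (tns V W) (x) idm (tns (dual W) (dual V))) \; lu (tns (dual W) (dual V)).

Definition reta (V W : Ob C) : Mor C one (tns (tns (dual W) (dual V)) (tns V W)) :=
  coevt W \; ((ruinv (dual W) \; (idm (dual W) (x) coevt V)) (x) idm W)
  \; (ascinv (dual W) (dual V) V (x) idm W) \; asc (tns (dual W) (dual V)) V W.

Definition rgamma (V W : Ob C) :
  Mor C (dual (tns V W)) (tns (dual W) (dual V)) :=
  luinv (dual (tns V W)) \; (reta V W (x) idm (dual (tns V W)))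
  \; asc (tns (dual W) (dual V)) (tns V W) (dual (tns V W))
  \; (idm (tns (dual W) (dual V)) (x) evt (tns V W)) \; ru (tns (dual W) (dual V)).

Definition phi (V : Ob C) : Mor C V (dual (dual V)) :=
  ruinv V \; (idm V (x) coev (dual V)) \; ascinv V (dual V) (dual (dual V))
  \; (evt V (x) idm (dual (dual V))) \; lu (dual (dual V)).

Definition is_inverse (A B : Ob C) (f : Mor C A B) (g : Mor C B A) :=
  mcomp g f = idm A /\ mcomp f g = idm B.

Definition isomorphic (A B : Ob C) :=
  exists (f : Mor C A B) (g : Mor C B A), is_inverse f g.

Definition biproduct (S A B : Ob C) (iA : Mor C A S) (pA : Mor C S A)
  (iB : Mor C B S) (pB : Mor C S B) :=
  [/\ mcomp pA iA = idm A, mcomp pB iB = idm B, mcomp pA iB = 0, mcomp pB iA = 0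
    & mcomp iA pA + mcomp iB pB = idm S].

Fixpoint mpow (A : Ob C) (f : Mor C A A) (n : nat) : Mor C A A :=
  if n is n'.+1 then mcomp f (mpow f n') else idm A.

(* Jacobson radical of the ring End(W) *)
Definition in_rad (W : Ob C) (r : Mor C W W) :=
  forall g : Mor C W W, exists h : Mor C W W, is_inverse (idm W - mcomp g r) h.

Definition indecomposable (W : Ob C) :=
  idm W <> 0 /\
  forall (A B : Ob C) (iA : Mor C A W) (pA : Mor C W A) (iB : Mor C B W) (pB : Mor C W B),
    biproduct iA pA iB pB -> idm A = 0 \/ idm B = 0.

Definition abs_indecomposable (W : Ob C) :=
  idm W <> 0 /\ forall f : Mor C W W, exists a : K, in_rad (f - a *: idm W).

Definition abs_simple (V : Ob C) :=
  idm V <> 0 /\ forall f : Mor C V V, exists a : K, f = a *: idm V.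

(* right ambidextrous; the paper's formula implicitly identifies (V (x) V^* )^*
   with V^** (x) V^* via the canonical isomorphism lgamma V (dual V). *)
Definition right_ambidextrous (V : Ob C) :=
  forall (psi : Mor C (dual (dual V)) V) (d : Mor C (tns (dual (dual V)) (dual V))
                                                     (dual (tns V (dual V)))),
    is_inverse (phi V) psi -> is_inverse (lgamma V (dual V)) d ->
    forall f : Mor C (tns V (dual V)) (tns V (dual V)),
      mcomp f (coev V) =
      coevt (dual V) \; d \; ldualm f \; lgamma V (dual V) \; (psi (x) idm (dual V)).

End Derived.

Section PivAx.
Context {K : fieldType} (C : PreCat K).
Local Notation "g \; f" := (mcomp f g) (at level 60, right associativity).
Local Notation "f (x) g" := (tensm f g) (at level 40, left associativity).
Local Notation tns := (tens C).
Local Notation one := (tunit C).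

Definition is_pivotal_cat : Prop :=
  (forall (A B : Ob C) (f : Mor C A B), mcomp (idm B) f = f) /\
  (forall (A B : Ob C) (f : Mor C A B), mcomp f (idm A) = f) /\
  (forall (A B D E : Ob C) (f : Mor C A B) (g : Mor C B D) (h : Mor C D E),
      mcomp h (mcomp g f) = mcomp (mcomp h g) f) /\
  (forall (A B D : Ob C) (g : Mor C B D), linear (fun f : Mor C A B => mcomp g f)) /\
  (forall (A B D : Ob C) (f : Mor C A B), linear (fun g : Mor C B D => mcomp g f)) /\
  (forall (A B D E : Ob C) (g : Mor C D E), linear (fun f : Mor C A B => f (x) g)) /\
  (forall (A B D E : Ob C) (f : Mor C A B), linear (fun g : Mor C D E => f (x) g)) /\
  (forall A B : Ob C, idm A (x) idm B = idm (tns A B)) /\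
  (forall (A1 A2 A3 B1 B2 B3 : Ob C) (f : Mor C A1 A2) (f' : Mor C A2 A3)
          (g : Mor C B1 B2) (g' : Mor C B2 B3),
      mcomp f' f (x) mcomp g' g = mcomp (f' (x) g') (f (x) g)) /\
  (forall A B D : Ob C, is_inverse (asc A B D) (ascinv A B D)) /\
  (forall A : Ob C, is_inverse (lu A) (luinv A)) /\
  (forall A : Ob C, is_inverse (ru A) (ruinv A)) /\
  (forall (A A' B B' D D' : Ob C) (f : Mor C A A') (g : Mor C B B') (h : Mor C D D'),
      ((f (x) g) (x) h) \; asc A' B' D' = asc A B D \; (f (x) (g (x) h))) /\
  (forall (A A' : Ob C) (f : Mor C A A'), (idm one (x) f) \; lu A' = lu A \; f) /\
  (forall (A A' : Ob C) (f : Mor C A A'), (f (x) idm one) \; ru A' = ru A \; f) /\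
  (forall A B D E : Ob C,
      (asc A B D (x) idm E) \; asc A (tns B D) E \; (idm A (x) asc B D E)
      = asc (tns A B) D E \; asc A B (tns D E)) /\
  (forall A B : Ob C, asc A one B \; (idm A (x) lu B) = ru A (x) idm B) /\
  idm one <> 0 /\
  (forall f : Mor C one one, exists a : K, f = a *: idm one) /\
  (exists Z : Ob C, idm Z = 0) /\
  (forall A B : Ob C, exists S (iA : Mor C A S) pA (iB : Mor C B S) pB,
      biproduct iA pA iB pB) /\
  (forall V : Ob C, luinv V \; (coev V (x) idm V) \; asc V (dual V) V \; (idm V (x) ev V) \; ru V
             = idm V) /\
  (forall V : Ob C, ruinv (dual V) \; (idm (dual V) (x) coev V) \; ascinv (dual V) V (dual V)
             \; (ev V (x) idm (dual V)) \; lu (dual V) = idm (dual V)) /\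
  (forall V : Ob C, ruinv V \; (idm V (x) coevt V) \; ascinv V (dual V) V \; (evt V (x) idm V) \; lu V
             = idm V) /\
  (forall V : Ob C, luinv (dual V) \; (coevt V (x) idm (dual V)) \; asc (dual V) V (dual V)
             \; (idm (dual V) (x) evt V) \; ru (dual V) = idm (dual V)) /\
  (* compatibility: the left and right dual functors coincide as monoidal functors *)
  (forall (V W : Ob C) (f : Mor C V W), ldualm f = rdualm f) /\
  (forall V W : Ob C, lgamma V W = rgamma V W).

Definition indec_abs_indec : Prop :=
  forall W : Ob C, indecomposable W -> abs_indecomposable W.

Definition indec_rad_nilpotent : Prop :=
  forall W : Ob C, indecomposable W ->
    forall r : Mor C W W, in_rad r -> exists n, mpow r n = 0.

End PivAx.

(* Main.v *)
(** Write X for V tensor V^*.  Since End(V) is one-dimensional, so are Hom(1, X)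
    and Hom(X, 1), spanned by coev V and evt V; hence every f in End(X) satisfies
    f coev = a(f) coev and evt f = b(f) evt for characters a, b of End(X).  Up to the
    canonical isomorphisms phi and gamma the dual of evt V is coevt (dual V), which
    is also (phi tensor id) coev V, so the right-hand side of the ambidexterity
    equation is b(f) coev V and V is right ambidextrous iff a = b.  As a(e_j) = 1 and
    b(e_k) = 0 for k <> j', this forces j = j'; conversely, if j = j' then both a and b
    factor through the unique character of the local ring End(W_j).
    If j = j', the isomorphism X -> X^* yields maps between W_j and its dual whose
    composites fix a nonzero vector of Hom(1, -), hence are invertible by locality.
    If W_j is self-dual, the nonzero map 1 -> W_j gives a nonzero map W_j -> 1, which
    composed with the projection is a multiple of evt V, so j = j'. *)

Require Import Defs.
From mathcomp Require Import all_boot all_order all_algebra.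
Set Implicit Arguments.
Unset Strict Implicit.
Unset Printing Implicit Defensive.
Import GRing.Theory.
Local Open Scope ring_scope.

Local Notation "g \; f" := (mcomp f g) (at level 60, right associativity).
Local Notation "f (x) g" := (tensm f g) (at level 40, left associativity).
Local Notation one C := (tunit C).

(** * Monoidal structure and its two reversal symmetries *)

Record monoidal {K : fieldType} (C : PreCat K) : Prop := Monoidal {
  compf1 : forall (A B : Ob C) (f : Mor C A B), f \; idm B = f;
  comp1f : forall (A B : Ob C) (f : Mor C A B), idm A \; f = f;
  compA : forall (A B D E : Ob C) (f : Mor C A B) (g : Mor C B D) (h : Mor C D E),
    (f \; g) \; h = f \; (g \; h);
  tens1 : forall A B : Ob C, idm A (x) idm B = idm (tens C A B);
  tensM : forall (A1 A2 A3 B1 B2 B3 : Ob C) (f : Mor C A1 A2) (f' : Mor C A2 A3)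
    (g : Mor C B1 B2) (g' : Mor C B2 B3),
    (f (x) g) \; (f' (x) g') = (f \; f') (x) (g \; g');
  ascK : forall A B D : Ob C, asc A B D \; ascinv A B D = idm _;
  ascinvK : forall A B D : Ob C, ascinv A B D \; asc A B D = idm _;
  luK : forall A : Ob C, lu A \; luinv A = idm _;
  luinvK : forall A : Ob C, luinv A \; lu A = idm _;
  ruK : forall A : Ob C, ru A \; ruinv A = idm _;
  ruinvK : forall A : Ob C, ruinv A \; ru A = idm _;
  asc_nat : forall (A A' B B' D D' : Ob C)
    (f : Mor C A A') (g : Mor C B B') (h : Mor C D D'),
    ((f (x) g) (x) h) \; asc A' B' D' = asc A B D \; (f (x) (g (x) h));
  lu_nat : forall (A A' : Ob C) (f : Mor C A A'),
    (idm (one C) (x) f) \; lu A' = lu A \; f;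
  ru_nat : forall (A A' : Ob C) (f : Mor C A A'),
    (f (x) idm (one C)) \; ru A' = ru A \; f;
  pentagon : forall A B D E : Ob C,
    (asc A B D (x) idm E) \; asc A (tens C B D) E \; (idm A (x) asc B D E)
    = asc (tens C A B) D E \; asc A B (tens C D E);
  triangle : forall A B : Ob C,
    asc A (one C) B \; (idm A (x) lu B) = ru A (x) idm B
}.

(* The monoidal axioms and the two dualities are stable under reversing the tensor
   product and under reversing arrows, so each diagram below is proved in one
   orientation only. *)
Definition rev {K : fieldType} (C : PreCat K) : PreCat K := {|
  Ob := Ob C; Mor := Mor C; idm := @idm K C; mcomp := @mcomp K C;
  tens A B := tens C B A; tunit := tunit C;
  tensm A B D E f g := tensm g f;
  asc A B D := ascinv D B A; ascinv A B D := asc D B A;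
  lu := ru; luinv := ruinv; ru := lu; ruinv := luinv; dual := dual;
  coev := coevt; ev := evt; coevt := coev; evt := ev |}.

Definition op {K : fieldType} (C : PreCat K) : PreCat K := {|
  Ob := Ob C; Mor A B := Mor C B A; idm := @idm K C;
  mcomp A B D g f := mcomp f g;
  tens := tens C; tunit := tunit C;
  tensm A B D E f g := tensm f g;
  asc := ascinv; ascinv := asc;
  lu := luinv; luinv := lu; ru := ruinv; ruinv := ru; dual := dual;
  coev := evt; ev := coevt; coevt := ev; evt := coev |}.

Section MonoidalLaws.
Context {K : fieldType} {C : PreCat K} (M : monoidal C).
Implicit Types A B D E F : Ob C.

Lemma comp_eq_r A B D E {f : Mor C A B} {g : Mor C B D} {k : Mor C A D} :
  f \; g = k -> forall h : Mor C D E, f \; (g \; h) = k \; h.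
Proof. by move=> <- h; rewrite (compA M). Qed.

Lemma comp_eq_r3 A B D E F {f : Mor C A B} {g : Mor C B D} {k : Mor C D E}
    {l : Mor C A E} :
  f \; (g \; k) = l -> forall h : Mor C E F, f \; (g \; (k \; h)) = l \; h.
Proof. by move=> <- h; rewrite !(compA M). Qed.

Lemma cancel_l A B D (f : Mor C A B) (f' : Mor C B A) (g h : Mor C B D) :
  f' \; f = idm B -> f \; g = f \; h -> g = h.
Proof.
move=> ff E; rewrite -(comp1f M g) -(comp1f M h) -ff.
by rewrite !(compA M) E.
Qed.

Lemma cancel_r A B D (f : Mor C B D) (f' : Mor C D B) (g h : Mor C A B) :
  f \; f' = idm B -> g \; f = h \; f -> g = h.
Proof.
move=> ff E; rewrite -(compf1 M g) -(compf1 M h) -ff.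
by rewrite -!(compA M) E.
Qed.

Lemma tensMl A A' A'' B (f : Mor C A A') (g : Mor C A' A'') :
  (f (x) idm B) \; (g (x) idm B) = (f \; g) (x) idm B.
Proof. by rewrite (tensM M) (comp1f M). Qed.

Lemma tensMr A A' A'' B (f : Mor C A A') (g : Mor C A' A'') :
  (idm B (x) f) \; (idm B (x) g) = idm B (x) (f \; g).
Proof. by rewrite (tensM M) (comp1f M). Qed.

Lemma tens_lr A A' B B' (f : Mor C A A') (g : Mor C B B') :
  (f (x) idm B) \; (idm A' (x) g) = f (x) g.
Proof. by rewrite (tensM M) (comp1f M) (compf1 M). Qed.

Lemma tens_rl A A' B B' (f : Mor C A A') (g : Mor C B B') :
  (idm A (x) g) \; (f (x) idm B') = f (x) g.
Proof. by rewrite (tensM M) (comp1f M) (compf1 M). Qed.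

Lemma ascinv_nat A A' B B' D D'
    (f : Mor C A A') (g : Mor C B B') (h : Mor C D D') :
  (f (x) (g (x) h)) \; ascinv A' B' D' = ascinv A B D \; ((f (x) g) (x) h).
Proof.
apply: (cancel_l (ascinvK M A B D)).
rewrite -(compA M) -(asc_nat M) (compA M) (ascK M) (compf1 M).
by rewrite (comp_eq_r (ascK M _ _ _)) (comp1f M).
Qed.

Lemma luinv_nat A A' (f : Mor C A A') :
  luinv A \; (idm (one C) (x) f) = f \; luinv A'.
Proof.
apply: (cancel_r (luK M A')).
by rewrite !(compA M) (lu_nat M) (luinvK M) (compf1 M) -(compA M) (luinvK M) (comp1f M).
Qed.

Lemma ruinv_nat A A' (f : Mor C A A') :
  ruinv A \; (f (x) idm (one C)) = f \; ruinv A'.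
Proof.
apply: (cancel_r (ruK M A')).
by rewrite !(compA M) (ru_nat M) (ruinvK M) (compf1 M) -(compA M) (ruinvK M) (comp1f M).
Qed.

Lemma ascinv_pentagon A B D E :
  (idm A (x) ascinv B D E) \; ascinv A (tens C B D) E \; (ascinv A B D (x) idm E)
  = ascinv A B (tens C D E) \; ascinv (tens C A B) D E.
Proof.
apply: (cancel_l (f := asc (tens C A B) D E \; asc A B (tens C D E))
  (f' := ascinv A B (tens C D E) \; ascinv (tens C A B) D E)).
  by rewrite (compA M) (comp_eq_r (ascinvK M _ _ _)) (comp1f M) (ascinvK M).
rewrite -{1}(pentagon M) !(compA M) (comp_eq_r (tensMr _ _ _)).
rewrite (ascK M) (tens1 M) (comp1f M) (comp_eq_r (ascK M _ _ _)) (comp1f M).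
rewrite tensMl (ascK M) (tens1 M).
by rewrite (comp_eq_r (ascK M _ _ _)) (comp1f M) (ascK M).
Qed.

Lemma ascinv_triangle A B :
  ascinv A (one C) B \; (ru A (x) idm B) = idm A (x) lu B.
Proof.
by rewrite -(triangle M) -(compA M) (ascinvK M) (comp1f M).
Qed.

Lemma triangle_inv A B :
  (ruinv A (x) idm B) \; asc A (one C) B = idm A (x) luinv B.
Proof.
apply: (cancel_r (f := idm A (x) lu B) (f' := idm A (x) luinv B)).
  by rewrite tensMr (luK M) (tens1 M).
by rewrite (compA M) (triangle M) tensMl tensMr (luinvK M) (ruinvK M) !(tens1 M).
Qed.

Lemma triangle_invinv A B :
  (idm A (x) luinv B) \; ascinv A (one C) B = ruinv A (x) idm B.
Proof. by rewrite -triangle_inv (compA M) (ascK M) (compf1 M). Qed.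

Lemma tens1_inj A B (f g : Mor C A B) :
  idm (one C) (x) f = idm (one C) (x) g -> f = g.
Proof.
move=> E; apply: (cancel_l (luinvK M A)).
by rewrite -!(lu_nat M) E.
Qed.

(** Kelly's argument: [tens1_inj] allows tensoring with the unit on the left, and precomposing with
    two invertible edges of the pentagon reduces the claim to two triangles. *)
Lemma lu_tens A B : asc (one C) A B \; lu (tens C A B) = lu A (x) idm B.
Proof.
apply: tens1_inj; rewrite -tensMr.
apply: (cancel_l (f := (asc (one C) (one C) A (x) idm B) \; asc (one C) (tens C (one C) A) B)
  (f' := ascinv (one C) (tens C (one C) A) B \; (ascinv (one C) (one C) A (x) idm B))).
  rewrite (compA M) (comp_eq_r (tensMl _ _ _)) (ascinvK M) (tens1 M).
  by rewrite (comp1f M) (ascinvK M).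
rewrite !(compA M) (comp_eq_r3 (pentagon M _ _ _ _)).
rewrite !(compA M) (triangle M) -(asc_nat M) -(tens1 M) -(asc_nat M).
by rewrite -(compA M) tensMl (triangle M).
Qed.
End MonoidalLaws.

Lemma rev_monoidal {K : fieldType} {C : PreCat K} : monoidal C -> monoidal (rev C).
Proof.
move=> M; split=> /=; try by case: M.
- by move=> *; rewrite (ascinv_nat M).
- by move=> *; rewrite (ascinv_pentagon M).
- by move=> *; rewrite (ascinv_triangle M).
Qed.

Lemma op_monoidal {K : fieldType} {C : PreCat K} : monoidal C -> monoidal (op C).
Proof.
move=> M; split=> /=; try by case: M.
- by move=> *; rewrite (ascinv_nat M).
- by move=> *; rewrite (luinv_nat M).
- by move=> *; rewrite (ruinv_nat M).
- by move=> *; rewrite (compA M) (ascinv_pentagon M).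
- by move=> *; rewrite (triangle_invinv M).
Qed.

(* (e (x) id) (id (x) c): the zigzags, [phi], [lgamma], [ldualm] are all of
   this form, and [snake'], [rgamma], [rdualm] are the same terms in [rev C]. *)
Definition snake {K : fieldType} {C : PreCat K} {P A Q : Ob C}
    (e : Mor C (tens C P A) (one C)) (c : Mor C (one C) (tens C A Q)) : Mor C P Q :=
  ruinv P \; (idm P (x) c) \; ascinv P A Q \; (e (x) idm Q) \; lu Q.

Definition snake' {K : fieldType} {C : PreCat K} {B A Q : Ob C}
    (c : Mor C (one C) (tens C A Q)) (e : Mor C (tens C Q B) (one C)) : Mor C B A :=
  luinv B \; (c (x) idm B) \; asc A Q B \; (idm A (x) e) \; ru A.

(* [leta V W] is [nested (coev V) (coev W)] and [reta V W] is
   [nested (coevt W) (coevt V)]. *)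
Definition nested {K : fieldType} {C : PreCat K} {A Q A' Q' : Ob C}
    (c : Mor C (one C) (tens C A Q)) (c' : Mor C (one C) (tens C A' Q')) :
    Mor C (one C) (tens C (tens C A A') (tens C Q' Q)) :=
  c \; ((ruinv A \; (idm A (x) c')) (x) idm Q) \; (ascinv A A' Q' (x) idm Q)
  \; asc (tens C A A') Q' Q.

Definition nested_ev {K : fieldType} {C : PreCat K} {A Q A' Q' : Ob C}
    (e : Mor C (tens C Q A) (one C)) (e' : Mor C (tens C Q' A') (one C)) :
    Mor C (tens C (tens C Q' Q) (tens C A A')) (one C) :=
  @nested K (op C) Q' A' Q A e' e.

(** * Unit coherence and the calculus of zigzags *)

Section Coherence.
Context {K : fieldType} {C : PreCat K} (M : monoidal C).
Implicit Types A B P Q X : Ob C.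
Local Notation I := (one C).

(** Tensoring with the unit on the right is faithful. The triangle and [lu_tens] then leave
    [lu (tens C I I)] against [idm I (x) lu I], which agree by naturality of [lu] at [lu I]. *)
Lemma lu1 : lu I = ru I.
Proof.
have inj1 (f g : Mor C (tens C I I) I) : f (x) idm I = g (x) idm I -> f = g.
  move=> E; apply: (cancel_l M (ruinvK M _)).
  by rewrite -!(ru_nat M) E.
apply: inj1; rewrite -(triangle M) -(lu_tens M); congr (_ \; _).
by apply: (cancel_r M (luK M I)); rewrite (lu_nat M).
Qed.

Lemma ru_tens A B : ascinv A B I \; ru (tens C A B) = idm A (x) ru B.
Proof. exact: (lu_tens (rev_monoidal M)). Qed.

Lemma luinv_tens A B : luinv (tens C A B) \; ascinv I A B = luinv A (x) idm B.
Proof. exact: (lu_tens (op_monoidal M)). Qed.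

Lemma pentagon_mid A B D E :
  (ascinv A B D (x) idm E) \; asc (tens C A B) D E =
  asc A (tens C B D) E \; (idm A (x) asc B D E) \; ascinv A B (tens C D E).
Proof.
apply: (cancel_r M (ascK M A B (tens C D E))).
rewrite !(compA M) (ascinvK M) (compf1 M) -(pentagon M) -(compA M) (tensMl M).
by rewrite (ascinvK M) (tens1 M) (comp1f M).
Qed.

(* Both sides insert [c] in the middle of [P (x) B] and then apply [e1 (x) e2]; this
   exchange replaces most diagram chases with duals. *)
Lemma snake_evl {P A Q B} (e1 : Mor C (tens C P A) I) (c : Mor C I (tens C A Q))
    (e2 : Mor C (tens C Q B) I) :
  (snake e1 c (x) idm B) \; e2 = (idm P (x) snake' c e2) \; e1.
Proof.
rewrite /snake /snake' -!(tensMl M) -!(tensMr M) !(compA M).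
rewrite -(lu_tens M) !(compA M) -(lu_nat M).
rewrite (comp_eq_r M (asc_nat M _ _ _)) !(compA M) (tens1 M).
rewrite (comp_eq_r M (pentagon_mid _ _ _ _)) !(compA M).
rewrite (comp_eq_r M (asc_nat M _ _ _)) !(compA M).
rewrite (comp_eq_r M (triangle_inv M _ _)).
rewrite -(ru_tens _ _) !(compA M) -(ru_nat M).
rewrite (comp_eq_r M (ascinv_nat M _ _ _)) !(compA M) (tens1 M).
by rewrite (comp_eq_r M (tens_lr M _ _)) (comp_eq_r M (tens_rl M _ _)) lu1.
Qed.

Lemma snake_natl {P' P A Q} (u : Mor C P' P) (e : Mor C (tens C P A) I)
    (c : Mor C I (tens C A Q)) :
  u \; snake e c = snake ((u (x) idm A) \; e) c.
Proof.
rewrite /snake -(compA M) -(ruinv_nat M) !(compA M) (comp_eq_r M (tens_lr M _ _)).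
rewrite -(tens_rl M u c) !(compA M) -(tens1 M) (comp_eq_r M (ascinv_nat M _ _ _)) !(compA M).
by rewrite -(tensMl M) !(compA M).
Qed.

Lemma snake_natr {P A Q Q'} (v : Mor C Q Q') (e : Mor C (tens C P A) I)
    (c : Mor C I (tens C A Q)) :
  snake e c \; v = snake e (c \; (idm A (x) v)).
Proof.
rewrite /snake !(compA M) -(lu_nat M) (comp_eq_r M (tens_lr M _ _)).
rewrite -(tensMr M) !(compA M) (comp_eq_r M (ascinv_nat M _ _ _)) !(compA M) (tens1 M).
by rewrite (comp_eq_r M (tens_rl M _ _)).
Qed.

Lemma snake_mid {P A A' Q} (w : Mor C A A') (e : Mor C (tens C P A') I)
    (c : Mor C I (tens C A Q)) :
  snake ((idm P (x) w) \; e) c = snake e (c \; (w (x) idm Q)).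
Proof.
rewrite /snake -(tensMr M) -(tensMl M) !(compA M).
by rewrite (comp_eq_r M (ascinv_nat M _ _ _)) !(compA M).
Qed.

(** The copairing [c'] may be inserted beside the right leg of [c] instead of the left one. The
    right-hand side is [nested] unfolded in [rev C], so nesting is invariant under reversal. *)
Lemma nested_revE {A Q A' Q'} (c : Mor C I (tens C A Q)) (c' : Mor C I (tens C A' Q')) :
  nested c c' = c \; (idm A (x) (luinv Q \; (c' (x) idm Q)))
    \; (idm A (x) asc A' Q' Q) \; ascinv A A' (tens C Q' Q).
Proof.
rewrite /nested (pentagon_mid _ _ _ _) -(tensMl M) -(tensMr M) !(compA M).
by rewrite (comp_eq_r M (asc_nat M _ _ _)) !(compA M) (comp_eq_r M (triangle_inv M _ _)).
Qed.

Lemma nested_rev {A Q A' Q'} (c : Mor C I (tens C A Q)) (c' : Mor C I (tens C A' Q')) :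
  nested c c' = @nested K (rev C) Q A Q' A' c c'.
Proof. exact: nested_revE. Qed.

Lemma nested_lu {A Q A' Q'} (c : Mor C I (tens C A Q)) (c' : Mor C I (tens C A' Q'))
    (e : Mor C (tens C A A') I) :
  nested c c' \; (e (x) idm (tens C Q' Q)) \; lu (tens C Q' Q)
  = c \; (snake e c' (x) idm Q).
Proof.
rewrite /nested /snake -!(tensMl M) !(compA M) -(lu_tens M) -(tens1 M).
by rewrite (comp_eq_r M (asc_nat M _ _ _)) !(compA M).
Qed.

(** The inner copairing [c'] can be closed up with the pairing before the outer one, so a nested
    zigzag is computed from the inside out. *)
Lemma snake'_nested {A Q A' Q' B} (c : Mor C I (tens C A Q))
    (c' : Mor C I (tens C A' Q')) (e : Mor C (tens C (tens C Q' Q) B) I) :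
  snake' (nested c c') e = luinv B \; (c (x) idm B) \; asc A Q B
    \; (idm A (x) snake' c' (ascinv Q' Q B \; e)).
Proof.
rewrite nested_revE /snake' -!(tensMr M) -!(tensMl M) !(compA M).
rewrite -(tens1 M) -(ru_tens _ _) (tens1 M) (comp_eq_r M (ascinv_nat M _ _ _)) !(compA M).
rewrite (comp_eq_r M (pentagon_mid _ _ _ _)) !(compA M) (tens1 M).
do 3! rewrite (comp_eq_r M (asc_nat M _ _ _)) !(compA M).
do 3! congr (_ \; _).
rewrite -!(compA M); do 3! congr (_ \; _).
rewrite !(tensMr M); congr (_ (x) _).
rewrite -(luinv_tens _ _) !(compA M); congr (_ \; _).
rewrite -(compA M (ascinv _ _ _)) -(ascinv_nat M) !(compA M) (tens1 M); congr (_ \; _).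
apply: (cancel_l M (ascinvK M _ _ _)).
apply: (cancel_r M (_ : (idm A' (x) asc Q' Q B) \; (idm A' (x) ascinv Q' Q B) = _)).
  by rewrite (tensMr M) (ascK M) (tens1 M).
by rewrite !(compA M) (tensMr M) (ascinvK M) (tens1 M) (compf1 M)
  (comp_eq_r M (ascK M _ _ _)) (comp1f M) (pentagon M).
Qed.

Lemma snake'_tens {A Q B X} (c : Mor C I (tens C A Q)) (e : Mor C (tens C Q B) I) :
  luinv (tens C B X) \; (c (x) idm (tens C B X)) \; asc A Q (tens C B X)
    \; (idm A (x) (ascinv Q B X \; (e (x) idm X) \; lu X))
  = snake' c e (x) idm X.
Proof.
rewrite /snake' -!(tensMr M) -!(tensMl M) -(luinv_tens _ _) !(compA M).
congr (_ \; _).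
rewrite -(compA M (ascinv _ _ _)) -(ascinv_nat M) !(compA M) (tens1 M); congr (_ \; _).
rewrite -(ascinv_triangle M) (comp_eq_r M (ascinv_nat M _ _ _)) !(compA M).
rewrite -!(compA M); do 2! congr (_ \; _).
apply: (cancel_l M (ascK M _ _ _)).
apply: (cancel_r M (_ : (ascinv A Q B (x) idm X) \; (asc A Q B (x) idm X) = _)).
  by rewrite (tensMl M) (ascinvK M) (tens1 M).
rewrite !(compA M) (ascinv_pentagon M) (comp_eq_r M (ascinvK M _ _ _)) (comp1f M).
by rewrite (tensMl M) (ascK M) (tens1 M) (compf1 M).
Qed.

(** With the unit as middle object nothing is bent: [e] is evaluated, then [s] is emitted. *)
Lemma snake_unit {P Q} (e : Mor C (tens C P I) I) (s : Mor C I Q) :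
  snake e (s \; luinv Q) = ruinv P \; e \; s.
Proof.
rewrite /snake -(luinv_nat M) -(tensMr M) !(compA M).
rewrite (comp_eq_r M (ascinv_nat M _ _ _)) !(compA M).
rewrite (comp_eq_r M (triangle_invinv M _ _)) (tens1 M).
rewrite (comp_eq_r M (tens_rl M _ _)) -(tens_lr M e s) !(compA M) (lu_nat M) lu1.
rewrite (comp_eq_r M (ruinv_nat M _)) (comp_eq_r M (ru_nat M _)) !(compA M).
by rewrite (comp_eq_r M (ruinvK M _)) (comp1f M).
Qed.

Lemma snake_lu {Q} (c : Mor C I (tens C I Q)) : snake (lu I) c = c \; lu Q.
Proof.
rewrite -[c in LHS](compf1 M) -(luK M) -(compA M) snake_unit lu1.
by rewrite (comp_eq_r M (ruinvK M _)) (comp1f M).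
Qed.
End Coherence.

Lemma snake_op {K : fieldType} {C : PreCat K} (M : monoidal C) (P A Q : Ob C)
    (e : Mor C (one C) (tens C P A)) (c : Mor C (tens C A Q) (one C)) :
  @snake K (op C) P A Q e c = snake' e c.
Proof. by rewrite /snake /snake' /= !(compA M). Qed.

Lemma snake'_op {K : fieldType} {C : PreCat K} (M : monoidal C) (B A Q : Ob C)
    (c : Mor C (tens C A Q) (one C)) (e : Mor C (one C) (tens C Q B)) :
  @snake' K (op C) B A Q c e = snake c e.
Proof. by rewrite /snake /snake' /= !(compA M). Qed.

(** * Dual pairs and their nesting *)

Section DualPairs.
Context {K : fieldType} {C : PreCat K} (M : monoidal C).
Implicit Types A B P Q X : Ob C.
Local Notation I := (one C).

Lemma snake_evr {P A Q B} (c1 : Mor C I (tens C P A)) (e : Mor C (tens C A Q) I)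
    (c2 : Mor C I (tens C Q B)) :
  c2 \; (snake' c1 e (x) idm B) = c1 \; (idm P (x) snake e c2).
Proof.
have := snake_evl (op_monoidal M) c1 e c2.
by rewrite (snake_op M) (snake'_op M).
Qed.

Lemma snake'_natl {B' B A Q} (u : Mor C B' B) (c : Mor C I (tens C A Q))
    (e : Mor C (tens C Q B) I) :
  u \; snake' c e = snake' c ((idm Q (x) u) \; e).
Proof. exact: (snake_natl (rev_monoidal M) u e c). Qed.

Lemma snake'_natr {B A A' Q} (v : Mor C A A') (c : Mor C I (tens C A Q))
    (e : Mor C (tens C Q B) I) :
  snake' c e \; v = snake' (c \; (v (x) idm Q)) e.
Proof. exact: (snake_natr (rev_monoidal M) v e c). Qed.

Definition dual_pair {A Q} (c : Mor C I (tens C A Q)) (e : Mor C (tens C Q A) I) :=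
  snake' c e = idm A /\ snake e c = idm Q.

Lemma nested_evE {A Q A' Q'} (e : Mor C (tens C Q A) I) (e' : Mor C (tens C Q' A') I) :
  nested_ev e e' = asc Q' Q (tens C A A')
    \; (idm Q' (x) (ascinv Q A A' \; (e (x) idm A') \; lu A')) \; e'.
Proof.
rewrite /nested_ev (nested_revE (op_monoidal M)) /=.
by rewrite -!(tensMr M) !(compA M).
Qed.

(** The inner zigzag cancels first; what remains is the outer zigzag with [A'] as a spectator, which
    [snake'_tens] handles. *)
Lemma nested_zigzag {A Q A' Q'} (c : Mor C I (tens C A Q)) (e : Mor C (tens C Q A) I)
    (c' : Mor C I (tens C A' Q')) (e' : Mor C (tens C Q' A') I) :
  snake' c e = idm A -> snake' c' e' = idm A' ->
  snake' (nested c c') (nested_ev e e') = idm (tens C A A').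
Proof.
move=> z z'; rewrite (snake'_nested M) nested_evE (comp_eq_r M (ascinvK M _ _ _)) (comp1f M).
have -> m : snake' c' ((idm Q' (x) m) \; e') = m :> Mor C (tens C Q (tens C A A')) A'.
  by rewrite -snake'_natl z' (compf1 M).
by rewrite (snake'_tens M) z (tens1 M).
Qed.
End DualPairs.

(** The second zigzag is the first one read in [rev C]. *)
Lemma nested_dual_pair {K : fieldType} {C : PreCat K} (M : monoidal C) (A Q A' Q' : Ob C)
    (c : Mor C (one C) (tens C A Q)) (e : Mor C (tens C Q A) (one C))
    (c' : Mor C (one C) (tens C A' Q')) (e' : Mor C (tens C Q' A') (one C)) :
  dual_pair c e -> dual_pair c' e' -> dual_pair (nested c c') (nested_ev e e').
Proof.
move=> [z y] [z' y']; split; first exact: (nested_zigzag M).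
rewrite (nested_rev M) /nested_ev (nested_rev (op_monoidal M)).
exact: (nested_zigzag (rev_monoidal M) y y').
Qed.

(** * The dual functor and uniqueness of duals *)

Record rigid {K : fieldType} (C : PreCat K) : Prop := Rigid {
  rigid_monoidal : monoidal C;
  coev_ev : forall V : Ob C, dual_pair (coev V) (ev V);
  coevt_evt : forall V : Ob C, dual_pair (coevt V) (evt V)
}.

Lemma rev_rigid {K : fieldType} {C : PreCat K} : rigid C -> rigid (rev C).
Proof.
case=> M l r; split; first exact: rev_monoidal.
  by move=> V; case: (r V).
by move=> V; case: (l V).
Qed.

Section Duals.
Context {K : fieldType} {C : PreCat K} (R : rigid C).
Let M := rigid_monoidal R.
Implicit Types U V W : Ob C.
Local Notation I := (one C).

Lemma snake'_coev V : snake' (coev V) (ev V) = idm V.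
Proof. by case: (coev_ev R V). Qed.

Lemma snake_coev V : snake (ev V) (coev V) = idm (dual V).
Proof. by case: (coev_ev R V). Qed.

Lemma snake'_coevt V : snake' (coevt V) (evt V) = idm (dual V).
Proof. by case: (coevt_evt R V). Qed.

Lemma snake_coevt V : snake (evt V) (coevt V) = idm V.
Proof. by case: (coevt_evt R V). Qed.

Lemma to_dual_inj {U V} (f g : Mor C U (dual V)) :
  (f (x) idm V) \; ev V = (g (x) idm V) \; ev V -> f = g.
Proof.
move=> E; rewrite -(compf1 M f) -(compf1 M g) -snake_coev.
by rewrite !(snake_natl M) E.
Qed.

Lemma ldualmE {V W} (f : Mor C V W) :
  ldualm f = snake (ev W) (coev V \; (f (x) idm (dual V))).
Proof. by rewrite /ldualm /snake -!(tensMr M) !(compA M). Qed.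

(** Together with [to_dual_inj] this sliding rule characterises [ldualm f]; contravariance and
    fullness are read off from it. *)
Lemma ldualm_ev {V W} (f : Mor C V W) :
  (ldualm f (x) idm V) \; ev V = (idm (dual W) (x) f) \; ev W.
Proof.
by rewrite ldualmE (snake_evl M) -(snake'_natr M) snake'_coev (comp1f M).
Qed.

Lemma ldualm_comp {U V W} (f : Mor C U V) (g : Mor C V W) :
  ldualm (f \; g) = ldualm g \; ldualm f.
Proof.
apply: to_dual_inj; rewrite ldualm_ev -(tensMl M) !(compA M) ldualm_ev.
rewrite (comp_eq_r M (tens_lr M _ _)) -(comp_eq_r M (tens_rl M (ldualm g) f)) ldualm_ev.
by rewrite -(compA M) (tensMr M).
Qed.

Lemma ldualm_id {V} : ldualm (idm V) = idm (dual V).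
Proof. by rewrite ldualmE (tens1 M) (compf1 M) snake_coev. Qed.

Lemma ldualm_full {V} (h : Mor C (dual V) (dual V)) :
  exists f : Mor C V V, ldualm f = h.
Proof.
exists (snake' (coev V) ((h (x) idm V) \; ev V)); apply: to_dual_inj.
by rewrite ldualm_ev -(snake_evl M) snake_coev (tens1 M) (comp1f M).
Qed.

(** Both [V] and [dual (dual V)] are dual to [dual V], one through [evt] and [coevt], the other
    through [ev] and [coev]. The witness is the comparison map in the opposite direction. *)
Lemma phi_iso V : exists psi, is_inverse (phi V) psi.
Proof.
exists (snake (ev (dual V)) (coevt V)); split.
  rewrite -[phi V]/(snake (evt V) (coev (dual V))) (snake_natl M) (snake_evl M).
  by rewrite snake'_coev (tens1 M) (comp1f M) snake_coevt.
rewrite (snake_natl M) (snake_evl M) snake'_coevt (tens1 M) (comp1f M).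
exact: snake_coev.
Qed.

(** Uniqueness of duals: each composite collapses by one zigzag from each pair. *)
Lemma dual_pair_iso {A Q Q'} (c : Mor C I (tens C A Q)) (e : Mor C (tens C Q A) I)
    (c' : Mor C I (tens C A Q')) (e' : Mor C (tens C Q' A) I) :
  dual_pair c e -> dual_pair c' e' -> is_inverse (snake e c') (snake e' c).
Proof.
move=> [z y] [z' y']; split.
  by rewrite (snake_natl M) (snake_evl M) z' (tens1 M) (comp1f M).
by rewrite (snake_natl M) (snake_evl M) z (tens1 M) (comp1f M).
Qed.

Lemma lgamma_iso V W : exists d, is_inverse (lgamma V W) d.
Proof.
exists (snake (nested_ev (ev V) (ev W)) (coev (tens C V W))).
apply: dual_pair_iso; first exact: coev_ev.
exact: (nested_dual_pair M (coev_ev R V) (coev_ev R W)).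
Qed.

(** Sliding [f] across [ev] leaves a pairing whose middle object is the unit. Hence [snake_unit]
    splits off the map from [dual I] to [I], and [f] contracts the nested copairing. *)
Lemma lgamma_ldualm {V W} (f : Mor C (tens C V W) I) :
  ldualm f \; lgamma V W =
  ruinv (dual I) \; ev I \; coev V \; (snake f (coev W) (x) idm (dual V)).
Proof.
rewrite -[lgamma V W]/(snake (ev (tens C V W)) (nested (coev V) (coev W))).
rewrite (snake_natl M) ldualm_ev (snake_mid M).
rewrite -[nested _ _ \; _](compf1 M) -(luK M (tens C (dual W) (dual V))) -(compA M) (snake_unit M).
by rewrite (compA M (nested _ _)) (nested_lu M).
Qed.

Lemma ev_coev_unit :
  (ruinv (dual I) \; ev I) \; (coev I \; lu (dual I)) = idm (dual I).
Proof.
by rewrite !(compA M) -(snake_unit M) (compA M) (luK M) (compf1 M) snake_coev.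
Qed.
End Duals.

Lemma evt_coevt_unit {K : fieldType} {C : PreCat K} (R : rigid C) :
  (luinv (dual (one C)) \; evt (one C)) \; (coevt (one C) \; ru (dual (one C)))
  = idm (dual (one C)).
Proof. exact: (ev_coev_unit (rev_rigid R)). Qed.

Lemma rgamma_rdualm {K : fieldType} {C : PreCat K} (R : rigid C) (V W : Ob C)
    (f : Mor C (tens C V W) (one C)) :
  rdualm f \; rgamma V W = luinv (dual (one C)) \; evt (one C) \; coevt W
    \; (idm (dual W) (x) snake' (coevt V) f).
Proof.
rewrite -[rgamma V W]/(snake' (nested (coevt W) (coevt V)) (evt (tens C V W))).
rewrite (nested_rev (rigid_monoidal R)).
exact: (@lgamma_ldualm K (rev C) (rev_rigid R) W V f).
Qed.

Lemma pivotal_rigid {K : fieldType} {C : PreCat K} : is_pivotal_cat C -> rigid C.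
Proof.
case=> H1 [H2 [H3 [_ [_ [_ [_ [H8 [H9 [H10 [H11 [H12 [H13 [H14 [H15 [H16 [H17]]]]]]]]]]]]]]]].
case=> _ [_ [_ [_ [H22 [H23 [H24 [H25 _]]]]]]].
split=> [|V|V]; [split=> // | by split | by split].
- by move=> A B D; case: (H10 A B D).
- by move=> A B D; case: (H10 A B D).
- by move=> A; case: (H11 A).
- by move=> A; case: (H11 A).
- by move=> A; case: (H12 A).
- by move=> A; case: (H12 A).
Qed.

(** * Linearity, and compatibility of the two dualities *)

Section Pivotal.
Context {K : fieldType} {C : PreCat K} (HC : is_pivotal_cat C).
Let R := pivotal_rigid HC.
Let M := rigid_monoidal R.
Implicit Types A B D P Q V W X : Ob C.
Local Notation I := (one C).

Lemma linear_scale (U U' : lmodType K) (h : U -> U') :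
  linear h -> forall a u, h (a *: u) = a *: h u.
Proof.
move=> L a u; have h0 : h 0 = 0.
  have := L 1 0 0; rewrite !scale1r addr0 => E.
  by apply: (@addrI _ (h 0)); rewrite -E addr0.
by have := L a u 0; rewrite !addr0 h0 addr0.
Qed.

Lemma compfZ {A B D} a (f : Mor C A B) (g : Mor C B D) : f \; (a *: g) = a *: (f \; g).
Proof.
by case: HC => _ [_ [_ [_ [L _]]]]; apply: (linear_scale (L _ _ _ f)).
Qed.

Lemma compZf {A B D} a (f : Mor C A B) (g : Mor C B D) : (a *: f) \; g = a *: (f \; g).
Proof.
by case: HC => _ [_ [_ [L _]]]; apply: (linear_scale (L _ _ _ g)).
Qed.

Lemma tensZf {A B D E} a (f : Mor C A B) (g : Mor C D E) : (a *: f) (x) g = a *: (f (x) g).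
Proof.
by case: HC => _ [_ [_ [_ [_ [L _]]]]]; apply: (linear_scale (L _ _ _ _ g)).
Qed.

Lemma tensfZ {A B D E} a (f : Mor C A B) (g : Mor C D E) : f (x) (a *: g) = a *: (f (x) g).
Proof.
by case: HC => _ [_ [_ [_ [_ [_ [L _]]]]]]; apply: (linear_scale (L _ _ _ _ f)).
Qed.

Lemma comp0f {A B D} (g : Mor C B D) : (0 : Mor C A B) \; g = 0.
Proof. by rewrite -(scale0r (0 : Mor C A B)) compZf scale0r. Qed.

Lemma compf0 {A B D} (f : Mor C A B) : f \; (0 : Mor C B D) = 0.
Proof. by rewrite -(scale0r (0 : Mor C B D)) compfZ scale0r. Qed.

Lemma tens0f {A B D E} (g : Mor C D E) : (0 : Mor C A B) (x) g = 0.
Proof. by rewrite -(scale0r (0 : Mor C A B)) tensZf scale0r. Qed.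

Lemma compDf {A B D} (f f' : Mor C A B) (g : Mor C B D) :
  (f + f') \; g = (f \; g) + (f' \; g).
Proof.
case: HC => _ [_ [_ [L _]]].
by have := L _ _ _ g 1 f f'; rewrite !scale1r.
Qed.

Lemma compfD {A B D} (f : Mor C A B) (g g' : Mor C B D) :
  f \; (g + g') = (f \; g) + (f \; g').
Proof.
case: HC => _ [_ [_ [_ [L _]]]].
by have := L _ _ _ f 1 g g'; rewrite !scale1r.
Qed.

Lemma ldualmZ {V W} a (f : Mor C V W) : ldualm (a *: f) = a *: ldualm f.
Proof. by rewrite /ldualm tensZf tensfZ compZf !compfZ. Qed.

Lemma idm_unit_neq0 : idm I <> 0.
Proof. by case: HC => _; do 16! case=> _; case. Qed.

Lemma End_unit (f : Mor C I I) : exists a, f = a *: idm I.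
Proof. by case: HC => _; do 17! case=> _; case. Qed.

Lemma ldualm_rdualm {V W} (f : Mor C V W) : ldualm f = rdualm f.
Proof. by case: HC => _; do 24! case=> _; case=> ->. Qed.

Lemma lgamma_rgamma V W : lgamma V W = rgamma V W.
Proof. by case: HC => _; do 25! case=> _; move=> ->. Qed.

Lemma dual_unit_neq0 : idm (dual I) <> 0.
Proof.
move=> d0; apply: idm_unit_neq0; rewrite -(snake'_coev R) /snake'.
have c0 : coev I = 0.
  by rewrite -(compf1 M (coev I)) -(tens1 M) d0 -(scale0r (idm _)) tensfZ scale0r compf0.
by rewrite c0 tens0f comp0f compf0.
Qed.

Lemma scale_inj {A B} (f : Mor C A B) a b : f <> 0 -> a *: f = b *: f -> a = b.
Proof.
move=> f0 /eqP; rewrite -subr_eq0 -scalerBl scaler_eq0 subr_eq0.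
by case/orP=> /eqP.
Qed.

(* The two identifications of the dual of the unit with the unit differ by a scalar
   [a]; comparing [lgamma] and [rgamma] on [lu I] gives [a^2 = a]. *)
Lemma ev_unit : ruinv (dual I) \; ev I = luinv (dual I) \; evt I.
Proof.
set l := _ \; ev I; set r := _ \; evt I.
set k := coev I \; lu (dual I); set k' := coevt I \; ru (dual I).
have lk : l \; k = idm _ := ev_coev_unit R.
have rk : r \; k' = idm _ := evt_coevt_unit R.
have [a ha] := End_unit (k \; r); have [b hb] := End_unit (k' \; r).
have rE : r = a *: l by rewrite -(compf1 M l) -compfZ -ha -(compA M) lk (comp1f M).
have r0 : r <> 0 by move=> r0; apply: dual_unit_neq0; rewrite -rk r0 comp0f.
have b1 : b = 1.
  by apply: (scale_inj r0); rewrite scale1r -{1}(compf1 M r) -compfZ -hb -(compA M) rk (comp1f M).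
have := lgamma_ldualm R (lu I).
rewrite ldualm_rdualm lgamma_rgamma (rgamma_rdualm R) (snake_lu M) -/k.
have -> : snake' (coevt I) (lu I) = k'.
  by rewrite (lu1 M) [LHS](snake_lu (rev_monoidal M)).
move/(congr1 (fun f => f \; ((r (x) r) \; lu I))).
rewrite -!(compA M) -/l -/r !(compA M).
rewrite !(comp_eq_r M (tensM M _ _ _ _)) ha hb !(comp1f M) b1 scale1r.
rewrite tensZf compZf !compfZ (lu_nat M) (lu1 M) (ru_nat M).
have -> : luinv (dual I) \; evt I \; coevt I \; ru (dual I) \; r = r.
  by rewrite -[RHS](comp1f M) -rk !(compA M).
have -> : ruinv (dual I) \; ev I \; coev I \; lu (dual I) \; r = r.
  by rewrite {2}rE -[l](compf1 M) -compfZ -ha !(compA M).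
by rewrite -{1}(scale1r r) => /(scale_inj r0) a1; rewrite rE -a1 scale1r.
Qed.

(** The opposite composite is the identity by [ev_coev_unit]; this one is a scalar because it lies
    in End(1), and the scalar is 1 because it fixes a nonzero map. *)
Lemma coev_ev_unit : (coev I \; lu (dual I)) \; (ruinv (dual I) \; ev I) = idm I.
Proof.
set k := _ \; lu _; set l := _ \; ev _.
have lk : l \; k = idm _ := ev_coev_unit R.
have [a ha] := End_unit (k \; l).
have l0 : l <> 0 by move=> l0; apply: dual_unit_neq0; rewrite -lk l0 comp0f.
rewrite ha (_ : a = 1) ?scale1r //; apply: (scale_inj l0).
by rewrite scale1r -{1}(compf1 M l) -compfZ -ha -(compA M) lk (comp1f M).
Qed.

(** The dual of [evt V] is computed twice: through [lgamma] it yields the left-hand side, through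
    [rgamma] the right-hand side. The prefactors on the dual of the unit agree by [ev_unit] and
    cancel. *)
Lemma phi_coev V : coev V \; (phi V (x) idm (dual V)) = coevt (dual V).
Proof.
apply: (cancel_l M coev_ev_unit).
rewrite {2}ev_unit !(compA M).
have := rgamma_rdualm R (evt V); rewrite (snake'_coevt R) (tens1 M) (compf1 M) => <-.
by rewrite -lgamma_rgamma -ldualm_rdualm (lgamma_ldualm R).
Qed.

Lemma coevt_ldualm V :
  (coev I \; lu (dual I)) \; ldualm (evt V) \; lgamma V (dual V) = coevt (dual V).
Proof.
rewrite (lgamma_ldualm R) -phi_coev -(compA M (ruinv _)).
by rewrite -(compA M (_ \; lu _)) coev_ev_unit (comp1f M).
Qed.

Lemma unit_coord V (f : Mor C I (tens C V (dual V))) :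
  f = coev V \; (snake' f (ev V) (x) idm (dual V)).
Proof. by rewrite (snake_evr M) (snake_coev R) (tens1 M) (compf1 M). Qed.

Lemma counit_coord V (f : Mor C (tens C V (dual V)) I) :
  f = (snake f (coevt V) (x) idm (dual V)) \; evt V.
Proof. by rewrite (snake_evl M) (snake'_coevt R) (tens1 M) (comp1f M). Qed.

Lemma coev_neq0 V : idm V <> 0 -> coev V <> 0.
Proof.
move=> V0 c0; apply: V0; rewrite -(snake'_coev R) /snake' c0.
by rewrite tens0f comp0f compf0.
Qed.

Lemma evt_neq0 V : idm V <> 0 -> evt V <> 0.
Proof.
move=> V0 c0; apply: V0; rewrite -(snake_coevt R) /snake c0.
by rewrite tens0f comp0f !compf0.
Qed.

Lemma unit_scalar V (f : Mor C I (tens C V (dual V))) :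
  abs_simple V -> exists a, f = a *: coev V.
Proof.
case=> _ S; case: (S (snake' f (ev V))) => a E; exists a.
by rewrite [LHS]unit_coord E tensZf (tens1 M) compfZ (compf1 M).
Qed.

Lemma counit_scalar V (f : Mor C (tens C V (dual V)) I) :
  abs_simple V -> exists a, f = a *: evt V.
Proof.
case=> _ S; case: (S (snake f (coevt V))) => a E; exists a.
by rewrite [LHS]counit_coord E tensZf (tens1 M) compZf (comp1f M).
Qed.

Section Ambidextrous.
Context {V : Ob C} {psi : Mor C (dual (dual V)) V}
  {d : Mor C (tens C (dual (dual V)) (dual V)) (dual (tens C V (dual V)))}.
Context (psiK : is_inverse (phi V) psi) (dK : is_inverse (lgamma V (dual V)) d).

Lemma coevt_d : coevt (dual V) \; d = (coev I \; lu (dual I)) \; ldualm (evt V).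
Proof.
case: dK => gd _; rewrite -coevt_ldualm -(compA M (_ \; lu _)).
by rewrite (compA M _ (lgamma _ _)) gd (compf1 M).
Qed.

Lemma coevt_psi : coevt (dual V) \; (psi (x) idm (dual V)) = coev V.
Proof.
case: psiK => pp _; rewrite -phi_coev !(compA M) (tensMl M).
by rewrite pp (tens1 M) (compf1 M).
Qed.

(** By [coevt_d] the chain starts with the dual of [evt V]. By contravariance [ldualm f] then turns
    it into the dual of [f \; evt V], so only the scalar [b] survives. *)
Lemma ambidextrous_rhs (f : Mor C (tens C V (dual V)) (tens C V (dual V))) b :
  f \; evt V = b *: evt V ->
  coevt (dual V) \; d \; ldualm f \; lgamma V (dual V) \; (psi (x) idm (dual V))
  = b *: coev V.
Proof.
move=> fb; rewrite -(compA M (coevt _)) coevt_d (compA M _ (ldualm _)).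
rewrite (comp_eq_r M (esym (ldualm_comp R _ _))) fb ldualmZ compZf compfZ.
by rewrite (comp_eq_r3 M (coevt_ldualm V)) coevt_psi.
Qed.
End Ambidextrous.

(** * Eigenvectors over local endomorphism rings *)

Section LocalEndomorphisms.
Context (Hind : indec_abs_indec C) (Hrad : indec_rad_nilpotent C).
Context {W : Ob C} (HW : indecomposable W).

Lemma local_decomp (h : Mor C W W) :
  exists a r, [/\ h = a *: idm W + r, in_rad r & exists n, mpow r n = 0].
Proof.
case: (Hind HW) => _ /(_ h) [a ra]; exists a, (h - a *: idm W).
by split; [rewrite addrC subrK | | exact: Hrad HW _ ra].
Qed.

Lemma eigen_fixed {X} (s : Mor C X W) (r : Mor C W W) a b n :
  s <> 0 -> mpow r n = 0 -> s \; (a *: idm W + r) = b *: s -> a = b.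
Proof.
move=> s0 rn; rewrite compfD compfZ (compf1 M) => /(canRL (addKr _)).
rewrite -scaleNr -scalerDl => sr.
(* The nilpotent part multiplies [s] by [- a + b], so a power of this scalar must vanish. *)
have sn m : s \; mpow r m = (- a + b) ^+ m *: s.
  elim: m => [|m IHm] /=; first by rewrite (compf1 M) scale1r.
  by rewrite -(compA M) IHm compZf sr scalerA exprSr.
have /eqP : (- a + b) ^+ n *: s = 0 by rewrite -sn rn compf0.
by rewrite scaler_eq0 expf_eq0 addrC subr_eq0 => /orP[/andP[_ /eqP]|/eqP].
Qed.

Lemma coeigen_fixed {X} (t : Mor C W X) (r : Mor C W W) a b n :
  t <> 0 -> mpow r n = 0 -> (a *: idm W + r) \; t = b *: t -> a = b.
Proof.
move=> t0 rn; rewrite compDf compZf (comp1f M) => /(canRL (addKr _)).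
rewrite -scaleNr -scalerDl => rt.
have tn m : mpow r m \; t = (- a + b) ^+ m *: t.
  elim: m => [|m IHm] /=; first by rewrite (comp1f M) scale1r.
  by rewrite (compA M) rt compfZ IHm scalerA exprS.
have /eqP : (- a + b) ^+ n *: t = 0 by rewrite -tn rn comp0f.
by rewrite scaler_eq0 expf_eq0 addrC subr_eq0 => /orP[/andP[_ /eqP]|/eqP].
Qed.

Lemma rad_unit (r : Mor C W W) : in_rad r -> exists h', is_inverse (1 *: idm W + r) h'.
Proof.
(* Taking minus the identity as the multiplier turns the radical condition into invertibility of the
   identity plus [r]. *)
case/(_ (- 1 *: idm W)) => h'; rewrite compfZ (compf1 M) scaleNr !scale1r opprK.
by exists h'.
Qed.

Lemma fixed_iso {X} (s : Mor C X W) (h : Mor C W W) :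
  s <> 0 -> s \; h = s -> exists h', is_inverse h h'.
Proof.
move=> s0 sh; have [a [r [E ra [n rn]]]] := local_decomp h.
have a1 : a = 1 by apply: (eigen_fixed s0 rn); rewrite -E sh scale1r.
by rewrite E a1; apply: rad_unit.
Qed.

Lemma cofixed_iso {X} (t : Mor C W X) (h : Mor C W W) :
  t <> 0 -> h \; t = t -> exists h', is_inverse h h'.
Proof.
move=> t0 th; have [a [r [E ra [n rn]]]] := local_decomp h.
have a1 : a = 1 by apply: (coeigen_fixed t0 rn); rewrite -E th scale1r.
by rewrite E a1; apply: rad_unit.
Qed.

(** Locality is transported from [W]: fullness of duality writes [h] as the dual of some [g], and
    bending [s] into a map from [W] to the unit makes [g] fix that map. *)
Lemma fixed_dual_iso (s : Mor C I (dual W)) (h : Mor C (dual W) (dual W)) :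
  s <> 0 -> s \; h = s -> exists h', is_inverse h h'.
Proof.
move=> s0; have [g <-] := ldualm_full R h => sg.
have [|| g' [gg' g'g]] := @cofixed_iso I (luinv W \; (s (x) idm W) \; ev W) g.
- move=> t0; apply: s0; apply: (to_dual_inj R); apply: (cancel_l M (luK M W)).
  by rewrite t0 tens0f comp0f compf0.
- rewrite -(compA M g) -(luinv_nat M) !(compA M) (comp_eq_r M (tens_rl M _ _)).
  rewrite -(tens_lr M s g) !(compA M) -(ldualm_ev R) (comp_eq_r M (tensMl M _ _ _)).
  by rewrite sg.
by exists (ldualm g'); split; rewrite -(ldualm_comp R) ?gg' ?g'g (ldualm_id R).
Qed.
End LocalEndomorphisms.

(** The hypotheses give [f] a right inverse [g \; u] and a left inverse [v \; g], which therefore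
    coincide. *)
Lemma iso_of_comps {A B} (f : Mor C A B) (g : Mor C B A) :
  (exists u, is_inverse (f \; g) u) -> (exists v, is_inverse (g \; f) v) ->
  isomorphic B A.
Proof.
move=> [u [fu _]] [v [_ vf]]; exists (g \; u), f; split; last by rewrite -(compA M).
have gu : v \; g = g \; u.
  by rewrite -[LHS](compf1 M) -fu !(compA M) -!(compA M) (compA M v) vf (comp1f M).
by rewrite -gu (compA M).
Qed.
End Pivotal.

(** * The cycle of implications *)

Theorem theorem3p3 (K : fieldType) (C : PreCat K)
  (HC : is_pivotal_cat C) (Hind : indec_abs_indec C) (Hrad : indec_rad_nilpotent C)
  (V : Ob C) (HV : abs_simple V)
  (I : finType) (W : I -> Ob C)
  (inc : forall k, Mor C (W k) (tens C V (dual V)))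
  (proj : forall k, Mor C (tens C V (dual V)) (W k))
  (Hpi : forall k, mcomp (proj k) (inc k) = idm (W k))
  (Hpi0 : forall k l, k != l -> mcomp (proj k) (inc l) = 0)
  (Hsum : \sum_k mcomp (inc k) (proj k) = idm (tens C V (dual V)))
  (HWind : forall k, indecomposable (W k))
  (j j' : I)
  (Hj : mcomp (mcomp (inc j) (proj j)) (coev V) = coev V)
  (Hj' : mcomp (evt V) (mcomp (inc j') (proj j')) = evt V) :
  [<-> right_ambidextrous V; j = j'; isomorphic (dual (W j)) (W j)].
Proof.
have R := pivotal_rigid HC; have M := rigid_monoidal R.
have [V0 _] := HV.
have c0 := coev_neq0 HC V0; have e0 := evt_neq0 HC V0.
have [psi psiK] := phi_iso R V.
have [d dK] := lgamma_iso R V (dual V).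
have s0 : coev V \; proj j <> 0.
  by move=> s0; apply: c0; rewrite -Hj -(compA M) s0 (comp0f HC).
have t0 : inc j' \; evt V <> 0.
  by move=> t0; apply: e0; rewrite -Hj' (compA M) t0 (compf0 HC).
(* Up to a scalar [proj j \; t] is [evt V], which factors through the summand [j']; for distinct
   indices [inc j] kills it, and [t] with it. *)
have jj' (t : Mor C (W j) (one C)) : t <> 0 -> j = j'.
  move=> nt; apply/eqP; apply/negP => /negP jj'; apply: nt.
  have [b tb] := counit_scalar HC (proj j \; t) HV.
  rewrite -(comp1f M t) -Hpi (compA M) tb -Hj' -(compfZ HC).
  by rewrite !(compA M) -(compA M (inc j)) Hpi0 1?eq_sym // (comp0f HC).
have amb : j = j' -> right_ambidextrous V.
  move=> E psi1 d1 psi1K d1K f; subst j'.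
  have [b fb] := counit_scalar HC (f \; evt V) HV.
  have [a fa] := unit_scalar HC (coev V \; f) HV.
  rewrite (ambidextrous_rhs HC psi1K d1K fb) fa; congr (_ *: _).
  (* The compression of [f] to [W j] has a single eigenvalue [c]. It equals [a] on the vector
     [coev V \; proj j] and [b] on the covector [inc j \; evt V]. *)
  have [c [r [hE _ [n rn]]]] := local_decomp Hind Hrad (HWind j) ((inc j \; f) \; proj j).
  have ca : c = a.
    apply: (eigen_fixed HC s0 rn); rewrite -hE -!(compA M).
    rewrite !(compA M) -(compA M (proj j)) -(compA M (coev V)) Hj.
    by rewrite -(compA M) fa (compZf HC).
  have cb : c = b.
    apply: (coeigen_fixed HC t0 rn); rewrite -hE !(compA M).
    by rewrite -(compA M (proj j)) Hj' fb (compfZ HC).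
  by rewrite -ca -cb.
split; [|split].
(* Ambidexterity is tested on the idempotent of index [j]: for distinct indices it kills [evt V], so
   its scalar [b] is 0, although it fixes the nonzero [coev V]. *)
- move=> A; case: (eqVneq j j') => // nj; case: c0.
  have [b eb] := counit_scalar HC ((proj j \; inc j) \; evt V) HV.
  have eb0 : b *: evt V = 0.
    rewrite -eb -{1}Hj'; move: (Hpi0 j' j); rewrite eq_sym => /(_ nj) z.
    by rewrite !(compA M) (comp_eq_r M z) (comp0f HC) (compf0 HC).
  have := A psi d psiK dK (proj j \; inc j).
  rewrite (ambidextrous_rhs HC psiK dK eb) [LHS]Hj => ->.
  by move/eqP: eb0; rewrite scaler_eq0 => /orP[/eqP->|/eqP//]; rewrite scale0r.
- move=> E; subst j'.
  (* Mutually inverse isomorphisms between V tensor V^* and its dual; only their effect on [coev V]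
     and on the dual of [evt V] is retained. *)
  pose th := (phi V (x) idm (dual V)) \; d.
  pose th' := lgamma V (dual V) \; (psi (x) idm (dual V)).
  have cth : coev V \; th = (coev (one C) \; lu (dual (one C))) \; ldualm (evt V).
    by rewrite -(coevt_d HC dK) -(phi_coev HC) (compA M).
  have thc : (coev (one C) \; lu (dual (one C))) \; ldualm (evt V) \; th' = coev V.
    by rewrite (comp_eq_r3 M (coevt_ldualm HC V)) (coevt_psi HC psiK).
  clearbody th th'.
  pose al := inc j \; th \; ldualm (inc j).
  pose be := ldualm (proj j) \; th' \; proj j.
  (* The idempotent fixes [coev V] and, since the indices agree, its dual fixes the dual of [evt V];
     so the round trip through the dual returns the same vector. *)
  have sab : (coev V \; proj j) \; (al \; be) = coev V \; proj j.
    have regroup a b : (coev V \; proj j) \; ((inc j \; th \; a) \; (b \; th' \; proj j))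
        = (((coev V \; proj j \; inc j) \; th) \; (a \; b)) \; th' \; proj j :> Mor C _ (W j).
      by rewrite !(compA M).
    rewrite regroup [coev V \; _]Hj cth -(ldualm_comp R) (compA M _ (ldualm (evt V))).
    rewrite -(ldualm_comp R) Hj' -(compA M _ th').
    by rewrite (compA M _ (ldualm _)) thc.
  apply: (iso_of_comps HC (f := al) (g := be)).
    exact: (fixed_iso HC Hind Hrad (HWind j) s0 sab).
  (* The vector fixed on the dual side is the image under [al], nonzero because [be] sends it
     back. *)
  apply: (fixed_dual_iso HC Hind Hrad (HWind j) (s := (coev V \; proj j) \; al)).
    by move=> z; apply: s0; rewrite -sab -(compA M) z (comp0f HC).
  by rewrite -(compA M _ be) !(compA M _ al) sab.
- case=> u [v [_ vu]]; apply: amb.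
  (* The nonzero vector of [W j] is carried to the dual by [v] and bent into a covector on [W j]. *)
  apply: (jj' (luinv (W j) \; (((coev V \; proj j) \; v) (x) idm (W j)) \; ev (W j))) => z.
  apply: s0; apply: (cancel_r M vu); rewrite (comp0f HC); apply: (to_dual_inj R).
  by apply: (cancel_l M (luK M (W j))); rewrite z (tens0f HC) (comp0f HC) (compf0 HC).
Qed.
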